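(* Let $\nu\in\mathbb{S}^2\subset\mathbb{R}^3$, and let $A_\nu$ and $\widehat{A}_\nu=C_\nu A_\nu C_\nu^T$ be the corresponding $9\times9$ symmetric matrices, with $3\times 3$ blocks $\widehat{A}'_\nu,\widehat{A}''_\nu$. For $M\in\mathbb{M}^9_{\rm sym}$ write $$\widehat{M}=C_\nu MC_\nu^T=\begin{pmatrix}\widehat{M}_1&\widehat{M}_2&\widehat{M}_2'\\(\widehat{M}_2)^T&\widehat{M}_3&\widehat{M}_3'\\(\widehat{M}_2')^T&(\widehat{M}_3')^T&\widehat{M}_3''\end{pmatrix}$$ in $3\times3$ blocks. Then $M$ satisfies the three conditions (i) $M$ is nonnegative (positive semidefinite), (ii) $\operatorname{Ker}A_\nu\subset\operatorname{Ker}M$, (iii) $\mathbb{R}^9=\operatorname{Ker}(A_\nu-M)+\operatorname{Ker}(A_\nu+M)$, if and only if all of the following hold: (a) $\widehat{M}_1$ and $\widehat{M}_3$ are positive definite; (b) $(\widehat{A}'_\nu)^T\widehat{M}_1^{-1}\widehat{M}_2$ and $\widehat{A}'_\nu\widehat{M}_3^{-1}(\widehat{M}_2)^T$ are skew symmetric; (c) $\widehat{M}_3=(\widehat{A}'_\nu)^T\widehat{M}_1^{-1}\widehat{A}'_\nu+(\widehat{M}_2)^T\widehat{M}_1^{-1}\widehat{M}_2$ and $\widehat{M}_1=\widehat{A}'_\nu\widehat{M}_3^{-1}(\widehat{A}'_\nu)^T+\widehat{M}_2\widehat{M}_3^{-1}(\widehat{M}_2)^T$; (d) $\widehat{M}_2'=\widehat{M}_2(\widehat{A}'_\nu)^{-1}\widehat{A}''_\nu$,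 $\widehat{M}_3'=\widehat{M}_3(\widehat{A}'_\nu)^{-1}\widehat{A}''_\nu$, $\widehat{M}_3''=(\widehat{A}''_\nu)^T(\widehat{A}'_\nu)^{-T}\widehat{M}_3(\widehat{A}'_\nu)^{-1}\widehat{A}''_\nu$; (e) $\operatorname{rk}(A_\nu+M)=\operatorname{rk}(A_\nu-M)=3$.
   Context: $\mathbb{M}^k$ (resp. $\mathbb{M}^k_{\rm sym}$) denotes the real (resp. real symmetric) $k\times k$ matrices. Fix real $\lambda,\mu$ with $\mu>0$ and $2\mu+3\lambda>0$, and set $\alpha=\frac23\sqrt{2\mu}+\frac13\sqrt{2\mu+3\lambda}$, $\beta=-\frac13\sqrt{2\mu}+\frac13\sqrt{2\mu+3\lambda}$. For $\nu=(\nu_1,\nu_2,\nu_3)\in\mathbb{S}^2$ let $$A'_\nu=-\begin{pmatrix}\nu_1\alpha&\nu_1\beta&\nu_1\beta\\\nu_2\beta&\nu_2\alpha&\nu_2\beta\\\nu_3\beta&\nu_3\beta&\nu_3\alpha\end{pmatrix},\quad A''_\nu=-\sqrt\mu\begin{pmatrix}\nu_2&\nu_3&0\\\nu_1&0&\nu_3\\0&\nu_1&\nu_2\end{pmatrix},\quad A_\nu=\begin{pmatrix}0&A'_\nu&A''_\nu\\(A'_\nu)^T&0&0\\(A''_\nu)^T&0&0\end{pmatrix}\in\mathbb{M}^9_{\rm sym}.$$ The $3\times6$ matrix $(A'_\nu|A''_\nu)$ has rank $3$. $C_\nu\in\mathbb{M}^9_{\rm sym}$ is a fixed (symmetric) permutation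 matrix leaving the first three coordinates unchanged, chosen so that in $$\widehat{A}_\nu:=C_\nu A_\nu C_\nu^T=\begin{pmatrix}0&\widehat{A}'_\nu&\widehat{A}''_\nu\\(\widehat{A}'_\nu)^T&0&0\\(\widehat{A}''_\nu)^T&0&0\end{pmatrix}$$ the $3\times3$ block $\widehat{A}'_\nu$ is invertible; one may take $C_\nu=\mathrm{I}_9$ if and only if $\nu_i\neq0$ for all $i$. *)

(* Defs.v *)
From mathcomp Require Import all_boot all_order all_algebra.
From mathcomp Require Import reals.

Set Implicit Arguments.
Unset Strict Implicit.
Unset Printing Implicit Defensive.

Import Order.TTheory GRing.Theory Num.Theory.
Local Open Scope ring_scope.

Section LinearAlgebra.
Variable R : realType.

(* The kernel of [B] acting on column vectors; [kermx] is the row kernel. *)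
Definition Ker (n : nat) (B : 'M[R]_n) : {vspace 'cV[R]_n} :=
  lker (linfun (mulmx B)).

Lemma mem_Ker n (B : 'M[R]_n) (v : 'cV[R]_n) :
  (v \in Ker B) = (B *m v == 0).
Proof. by rewrite /Ker memv_ker lfunE. Qed.

Definition psd (n : nat) (B : 'M[R]_n) : Prop :=
  B^T = B /\ forall v : 'cV[R]_n, 0 <= (v^T *m B *m v) 0 0.

Definition posdef (n : nat) (B : 'M[R]_n) : Prop :=
  B^T = B /\ forall v : 'cV[R]_n, v != 0 -> 0 < (v^T *m B *m v) 0 0.

Definition skew_sym (n : nat) (B : 'M[R]_n) : Prop := B^T = - B.

Definition mx33 (s : seq (seq R)) : 'M[R]_3 :=
  \matrix_(i < 3, j < 3) nth 0 (nth [::] s i) j.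

(* [blkij B] is the (i, j) block, i, j in {1, 2, 3}, of a 9 x 9 matrix cut
   into 3 x 3 blocks. *)
Definition blk11 (B : 'M[R]_(3 + (3 + 3))) : 'M[R]_3 := ulsubmx B.
Definition blk12 (B : 'M[R]_(3 + (3 + 3))) : 'M[R]_3 := lsubmx (ursubmx B).
Definition blk13 (B : 'M[R]_(3 + (3 + 3))) : 'M[R]_3 := rsubmx (ursubmx B).
Definition blk22 (B : 'M[R]_(3 + (3 + 3))) : 'M[R]_3 := ulsubmx (drsubmx B).
Definition blk23 (B : 'M[R]_(3 + (3 + 3))) : 'M[R]_3 := ursubmx (drsubmx B).
Definition blk33 (B : 'M[R]_(3 + (3 + 3))) : 'M[R]_3 := drsubmx (drsubmx B).

End LinearAlgebra.

Section Elasticity.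
Variables (R : realType) (lam mu : R).

Definition alpha : R :=
  2%:R / 3%:R * Num.sqrt (2%:R * mu)
  + 1 / 3%:R * Num.sqrt (2%:R * mu + 3%:R * lam).

Definition beta : R :=
  - (1 / 3%:R) * Num.sqrt (2%:R * mu)
  + 1 / 3%:R * Num.sqrt (2%:R * mu + 3%:R * lam).

Variable nu : 'rV[R]_3.

Definition on_sphere : Prop := \sum_(i < 3) nu 0 i ^+ 2 = 1.

Let n1 : R := nu 0 (inord 0).
Let n2 : R := nu 0 (inord 1).
Let n3 : R := nu 0 (inord 2).

Definition A' : 'M[R]_3 :=
  - mx33 [:: [:: n1 * alpha; n1 * beta;  n1 * beta ];
             [:: n2 * beta;  n2 * alpha; n2 * beta ];
             [:: n3 * beta;  n3 * beta;  n3 * alpha ]].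

Definition A'' : 'M[R]_3 :=
  - Num.sqrt mu *: mx33 [:: [:: n2; n3; 0 ];
                            [:: n1; 0;  n3 ];
                            [:: 0;  n1; n2 ]].

Definition A : 'M[R]_(3 + (3 + 3)) :=
  block_mx 0 (row_mx A' A'') (col_mx A'^T A''^T) 0.

(* [usubmx C = row_mx 1%:M 0] says that the permutation leaves the first three
   coordinates unchanged. *)
Definition admissible (C : 'M[R]_(3 + (3 + 3))) : Prop :=
  [/\ is_perm_mx C, C^T = C, usubmx C = row_mx 1%:M 0
    & blk12 (C *m A *m C^T) \in unitmx].

End Elasticity.

(* Main.v *)
Require Import Defs.
From mathcomp Require Import all_boot all_order all_algebra.
From mathcomp Require Import reals fingroup perm.
From mathcomp Require Import zify ring lra.

Import Order.TTheory GRing.Theory Num.Theory.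
Local Open Scope ring_scope.

(* Since C is orthogonal, conditions (i)-(iii) can be read on the conjugated
   pair B = C A C^T, N = C M C^T, where B = [0 a b; a^T 0 0; b^T 0 0] with a
   invertible, so that rk B = 6.  Condition (ii) evaluated on a basis of Ker B
   is (d).  Given (ii), Ker (B - N) and Ker (B + N) meet in Ker B, so (iii)
   amounts to rk (B - N) + rk (B + N) = rk B = 6.  The form of B (resp. - B) is
   negative definite on the graph of - a^-1 (resp. a^-1); as N >= 0, both ranks
   are at least 3, whence (e).  Moreover (iii) forces Ker N = Ker B, which meets
   each of the first two coordinate blocks trivially, whence (a).  Finally,
   N + B and N - B have rank 3 and an invertible 3 x 3 diagonal block, so their
   Schur complements vanish: M3 = (M2 + a)^T M1^-1 (M2 + a) =
   (M2 - a)^T M1^-1 (M2 - a), and half the sum and the difference of these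
   equations are (c) and (b); the roles of M1 and M3 can be exchanged.
   Conversely (c) and (d) exhibit N as a sum of two congruences of M1. *)

(** * Semidefinite and definite matrices *)

Lemma tr_mul_self_eq0 {R : realType} {n : nat} (w : 'cV[R]_n) :
  (w^T *m w) 0 0 = 0 -> w = 0.
Proof.
rewrite mxE => /eqP; rewrite psumr_eq0 => [/allP w0|i _]; last first.
  by rewrite mxE -expr2 sqr_ge0.
apply/colP => i; rewrite mxE.
by have := w0 i (mem_index_enum i); rewrite mxE -expr2 sqrf_eq0 => /eqP.
Qed.

Lemma quad_coef_eq0 {R : realFieldType} {s c : R} :
  0 <= c -> (forall t, 0 <= 2 * t * s + t ^+ 2 * c) -> s = 0.
Proof.
move=> c_ge0 quad.
(* The minimiser would be [- s / c]; the denominator [c + 1] avoids division by zero, and the value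
   at this point is still negative unless [s = 0]. *)
have := quad (- (s / (c + 1))).
have -> : 2 * (- (s / (c + 1))) * s + (- (s / (c + 1))) ^+ 2 * c
        = - (s / (c + 1)) ^+ 2 * (c + 2) by field; lra.
have := sqr_ge0 (s / (c + 1)).
move=> h1 h2.
have : (s / (c + 1)) ^+ 2 = 0 by nra.
move/eqP; rewrite sqrf_eq0 mulf_eq0 invr_eq0 => /orP[/eqP //|/eqP]; lra.
Qed.

(** Moving from [v] in the direction [w = N *m v], the form becomes [2 * t * s + t ^+ 2 * c] with
    [s] the squared norm of [w]. It is nonnegative for all [t], so its linear coefficient
    vanishes. *)
Lemma psd_null {R : realType} {n : nat} {N : 'M[R]_n} {v : 'cV[R]_n} :
  psd N -> (v^T *m N *m v) 0 0 = 0 -> N *m v = 0.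
Proof.
move=> [Nsym N_ge0] vNv; set w := N *m v; apply: tr_mul_self_eq0.
set s : R := (w^T *m w) 0 0; set c : R := (w^T *m N *m w) 0 0.
have c_ge0 : 0 <= c by exact: N_ge0.
have quad t : 0 <= 2 * t * s + t ^+ 2 * c.
  have := N_ge0 (v + t *: w).
  have -> : (v + t *: w)^T = v^T + t *: w^T by rewrite linearD linearZ.
  rewrite !(mulmxDl, mulmxDr).
  rewrite -!scalemxAr -!scalemxAl.
  have -> : v^T *m N *m w = w^T *m w by rewrite /w trmx_mul Nsym.
  have -> : w^T *m N *m v = w^T *m w by rewrite -mulmxA.
  have addE (X Y : 'M[R]_1) : (X + Y) 0 0 = X 0 0 + Y 0 0 by rewrite mxE.
  have scaleE a (X : 'M[R]_1) : (a *: X) 0 0 = a * X 0 0 by rewrite mxE.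
  rewrite !(addE, scaleE) vNv -/s -/c.
  by move=> /le_trans; apply; lra.
exact: quad_coef_eq0 c_ge0 quad.
Qed.

Lemma psd_congr {R : realType} {m n : nat} (P : 'M[R]_(m, n)) {N : 'M[R]_m} :
  psd N -> psd (P^T *m N *m P).
Proof.
move=> [Nsym N_ge0]; split; first by rewrite !trmx_mul trmxK Nsym mulmxA.
by move=> v; have := N_ge0 (P *m v); rewrite trmx_mul !mulmxA.
Qed.

Lemma psdD {R : realType} {n : nat} {N N' : 'M[R]_n} :
  psd N -> psd N' -> psd (N + N').
Proof.
move=> [Ns N0] [N's N'0]; split; first by rewrite linearD /= Ns N's.
by move=> v; rewrite mulmxDr mulmxDl mxE addr_ge0.
Qed.

Lemma posdef_psd {R : realType} {n : nat} {N : 'M[R]_n} : posdef N -> psd N.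
Proof.
move=> [Ns N0]; split=> // v; have [->|/N0/ltW//] := eqVneq v 0.
by rewrite mulmx0 mxE.
Qed.

(** By [psd_null], a vector on which the congruent form vanishes is sent by [P] into the kernel of
    [N]. With [P] a coordinate inclusion this is the source of (a). *)
Lemma psd_posdef_congr {R : realType} {m n : nat} {P : 'M[R]_(m, n)}
    {N : 'M[R]_m} :
  psd N -> (forall x : 'cV_n, N *m (P *m x) = 0 -> x = 0) ->
  posdef (P^T *m N *m P).
Proof.
move=> Npsd NP0; have [PNPs PNP0] := psd_congr P Npsd; split=> // v v0.
rewrite lt_neqAle PNP0 andbT eq_sym; apply: contra_neq v0 => vNv.
by apply: NP0; apply: (psd_null Npsd); rewrite trmx_mul !mulmxA in vNv *.
Qed.

Lemma posdef_unit {R : realType} {n : nat} {N : 'M[R]_n} :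
  posdef N -> N \in unitmx.
Proof.
move=> [Ns N0]; rewrite -row_free_unit -kermx_eq0; apply/eqP/row_matrixP => i.
rewrite row0; apply/eqP; apply: contraTT isT => ri0.
have := N0 (row i (kermx N))^T; rewrite trmx_eq0 => /(_ ri0).
by rewrite trmxK -row_mul mulmx_ker row0 mul0mx mxE ltxx.
Qed.

(** * Kernels, sums of kernels and ranks *)

Lemma Ker_subP {R : realType} {n : nat} {X Y : 'M[R]_n} :
  (Ker X <= Ker Y)%VS <->
  (forall (k : nat) (W : 'M_(n, k)), X *m W = 0 -> Y *m W = 0).
Proof.
split=> [/subvP XY k W XW|XY].
  apply/trmx_inj/row_matrixP => i.
  rewrite trmx0 row0 -tr_col colE -mulmxA.
  have := XY (W *m delta_mx i 0); rewrite !mem_Ker mulmxA XW mul0mx eqxx.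
  by move=> /(_ isT)/eqP->; rewrite trmx0.
by apply/subvP => v; rewrite !mem_Ker => /eqP/XY->.
Qed.

Lemma Ker_addP {R : realType} {n : nat} {X Y : 'M[R]_n} :
  (Ker X + Ker Y)%VS = fullv <->
  (forall u : 'cV_n, exists p q : 'cV_n,
     [/\ u = p + q, X *m p = 0 & Y *m q = 0]).
Proof.
split=> [XY u|XY].
  have /memv_addP[p Xp [q Yq ->]] : u \in (Ker X + Ker Y)%VS.
    by rewrite XY memvf.
  by move: Xp Yq; rewrite !mem_Ker => /eqP Xp /eqP Yq; exists p, q.
apply/eqP; rewrite eqEsubv subvf; apply/subvP => u _.
have [p [q [-> Xp Yq]]] := XY u.
by apply: memv_add; rewrite mem_Ker ?Xp ?Yq.
Qed.

(** For symmetric matrices, transposition exchanges column kernels and row kernels, so the dimension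
    formula for row spaces becomes available. *)
Lemma Ker_add_kermx {R : realType} {n : nat} {X Y : 'M[R]_n} :
  X^T = X -> Y^T = Y ->
  (Ker X + Ker Y)%VS = fullv <-> \rank (kermx X + kermx Y)%MS = n.
Proof.
move=> Xs Ys; rewrite Ker_addP; split=> [XY|/eqP XY u].
  apply/eqP; rewrite -[_ == _]/(row_full _) -sub1mx; apply/row_subP => i.
  have [p [q [pq Xp Yq]]] := XY (row i 1%:M)^T.
  rewrite -[row i _]trmxK pq linearD /= addmx_sub_adds //; apply/sub_kermxP.
    by rewrite -[X]Xs -trmx_mul Xp trmx0.
  by rewrite -[Y]Ys -trmx_mul Yq trmx0.
have /sub_addsmxP[[a b] /= uE] : (u^T <= kermx X + kermx Y)%MS.
  exact: submx_full.
exists (a *m kermx X)^T, (b *m kermx Y)^T; split.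
- by rewrite -linearD /= -uE trmxK.
- by rewrite -[X in X *m _ = _]Xs -trmx_mul -mulmxA mulmx_ker mulmx0 trmx0.
- by rewrite -[Y in Y *m _ = _]Ys -trmx_mul -mulmxA mulmx_ker mulmx0 trmx0.
Qed.

Lemma Ker_add_rank {R : realType} {n : nat} {B N : 'M[R]_n} :
  B^T = B -> N^T = N -> (Ker B <= Ker N)%VS ->
  (Ker (B - N) + Ker (B + N))%VS = fullv <->
  (\rank (B - N)%R + \rank (B + N)%R)%N = \rank B.
Proof.
move=> Bs Ns /Ker_subP BN.
rewrite Ker_add_kermx ?linearD ?linearN /= ?Bs ?Ns //.
(* A row killed by [B - N] and by [B + N] is killed by twice [B]; conversely, [Ker B] lies in
   [Ker N]. The dimension formula then involves only the three ranks. *)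
have capE : \rank (kermx (B - N) :&: kermx (B + N))%MS = \rank (kermx B).
  apply/eqmx_rank/andP; split.
    apply/sub_kermxP; set K := (_ :&: _)%MS.
    have /sub_kermxP : (K <= kermx (B - N))%MS by exact: capmxSl.
    have /sub_kermxP : (K <= kermx (B + N))%MS by exact: capmxSr.
    rewrite mulmxDr mulmxBr => KBN KBN'.
    apply: (@scalerI _ _ (2 : R)); first by rewrite pnatr_eq0.
    rewrite scaler0 scaler_nat mulr2n.
    by rewrite -{1}[K *m B](addrK (K *m N)) KBN add0r addrC KBN'.
  have KN : kermx B *m N = 0.
    rewrite -Ns -[kermx B]trmxK -trmx_mul BN ?trmx0 //.
    by rewrite -{1}Bs -trmx_mul mulmx_ker trmx0.
  rewrite sub_capmx; apply/andP; split; apply/sub_kermxP.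
    by rewrite mulmxBr mulmx_ker KN subr0.
  by rewrite mulmxDr mulmx_ker KN addr0.
have := mxrank_sum_cap (kermx (B - N)) (kermx (B + N)).
rewrite capE !mxrank_ker.
have := rank_leq_row (B - N); have := rank_leq_row (B + N).
have := rank_leq_row B; lia.
Qed.

(* The rank hypothesis makes the columns of [K *m V] span those of [K], so
   that [K = K *m V *m X], and left multiplication by [U] determines [X]. *)
Lemma rank_factor {F : fieldType} {m n k : nat} {K : 'M[F]_(m, n)}
    {U : 'M[F]_(k, m)} {V : 'M[F]_(n, k)} :
  (\rank K <= k)%N -> U *m K *m V \in unitmx ->
  K = K *m V *m invmx (U *m K *m V) *m (U *m K).
Proof.
move=> rK UKV; have KVsub : ((K *m V)^T <= K^T)%MS.
  by rewrite trmx_mul submxMl.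
have : (K^T <= (K *m V)^T)%MS.
  rewrite -(geq_leqif (mxrank_leqif_sup KVsub)) !mxrank_tr (leq_trans rK) //.
  by rewrite -{1}(mxrank_unit UKV) -mulmxA mxrankM_maxr.
case/submxP => X /(congr1 trmx); rewrite trmxK trmx_mul trmxK => KE.
have UKE : U *m K = U *m K *m V *m X^T by rewrite {1}KE !mulmxA.
by rewrite {2}UKE -mulmxA mulKmx.
Qed.

(** * Conditions (i)-(iii) and their consequences *)

Definition friedrichs_admissible {R : realType} {n : nat}
    (B N : 'M[R]_n) : Prop :=
  [/\ psd N, (Ker B <= Ker N)%VS & (Ker (B - N) + Ker (B + N))%VS = fullv].

Lemma friedrichs_admissible_congr {R : realType} {n : nat} {P B N : 'M[R]_n} :
  P *m P^T = 1%:M -> friedrichs_admissible B N ->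
  friedrichs_admissible (P *m B *m P^T) (P *m N *m P^T).
Proof.
move=> PP' [Npsd /Ker_subP BN /Ker_addP BN_sum].
have P'P : P^T *m P = 1%:M by exact: mulmx1C.
have PK (X : 'M[R]_n) k (W : 'M_(n, k)) :
    X *m (P^T *m W) = 0 -> P *m X *m P^T *m W = 0.
  by rewrite -!mulmxA => ->; rewrite mulmx0.
have PKV (X : 'M[R]_n) k (W : 'M_(n, k)) :
    P *m X *m P^T *m W = 0 -> X *m (P^T *m W) = 0.
  by move/(congr1 (mulmx P^T)); rewrite !mulmxA P'P mul1mx mulmx0 -mulmxA.
split.
- by have := psd_congr P^T Npsd; rewrite trmxK.
- by apply/Ker_subP => k W /PKV/BN/PK.
- rewrite -!(mulmxBl, mulmxDl) -!(mulmxBr, mulmxDr).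
  apply/Ker_addP => u; have [p [q [uE Bp Bq]]] := BN_sum (P^T *m u).
  exists (P *m p), (P *m q); split.
  + by rewrite -mulmxDr -uE mulmxA PP' mul1mx.
  + by apply: PK; rewrite [P^T *m _]mulmxA P'P mul1mx.
  + by apply: PK; rewrite [P^T *m _]mulmxA P'P mul1mx.
Qed.

Lemma friedrichs_admissible_congrE {R : realType} {n : nat} {P B N : 'M[R]_n} :
  P *m P^T = 1%:M ->
  friedrichs_admissible (P *m B *m P^T) (P *m N *m P^T) <->
  friedrichs_admissible B N.
Proof.
move=> PP'; split; last exact: friedrichs_admissible_congr.
have P'P : P^T *m P = 1%:M by exact: mulmx1C.
have PK (X : 'M[R]_n) : P^T *m (P *m X *m P^T) *m P^T^T = X.
  by rewrite trmxK !mulmxA P'P mul1mx -mulmxA P'P mulmx1.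
have P'P1 : P^T *m P^T^T = 1%:M by rewrite trmxK.
by move=> /(friedrichs_admissible_congr P'P1); rewrite !PK.
Qed.

(** Reverse of the inclusion (ii). Write [u = p + q] with [B *m p = N *m p] and
    [B *m q = - (N *m q)]. If [N *m u = 0], then [p - q] lies in [Ker B], hence in [Ker N]; so
    [N *m p] and [N *m q] are both equal and opposite, and vanish. *)
Lemma friedrichs_Ker {R : realType} {n : nat} {B N : 'M[R]_n} {u : 'cV_n} :
  friedrichs_admissible B N -> N *m u = 0 -> B *m u = 0.
Proof.
move=> [_ /Ker_subP BN /Ker_addP/(_ u)[p [q [-> Bp Bq]]]].
move: Bp Bq; rewrite mulmxBl mulmxDl => /eqP; rewrite subr_eq0 => /eqP Bp.
move=> /eqP; rewrite addr_eq0 => /eqP Bq Npq.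
have /BN/eqP : B *m (p - q) = 0.
  by rewrite mulmxBr Bp Bq opprK -mulmxDr.
rewrite mulmxBr subr_eq0 => /eqP Npq'.
move/eqP: Npq; rewrite mulmxDr Npq' -mulr2n -scaler_nat scaler_eq0 pnatr_eq0.
by move=> /= /eqP Nq0; rewrite mulmxDr Bp Bq Npq' Nq0 oppr0 addr0.
Qed.

Lemma col_inj_rank {F : fieldType} {m n : nat} {X : 'M[F]_(m, n)} :
  (forall x : 'cV_n, X *m x = 0 -> x = 0) -> \rank X = n.
Proof.
move=> Xinj; rewrite -mxrank_tr; apply/eqP; rewrite -[_ == _]/(row_free _).
rewrite -kermx_eq0; apply/eqP/row_matrixP => i; rewrite row0.
apply: trmx_inj; rewrite trmx0; apply: Xinj; apply: trmx_inj.
by rewrite trmx_mul trmxK -row_mul mulmx_ker row0 trmx0.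
Qed.

(** If [B - N] kills [W *m x], the form of [N] at [W *m x] equals that of [B], which is minus twice
    the squared norm of [x]; nonnegativity of [N] forces [x = 0]. So [(B - N) *m W] is injective. *)
Lemma rank_sub_psd {R : realType} {m n : nat} {B N : 'M[R]_n}
    {W : 'M_(n, m)} :
  psd N -> W^T *m B *m W = - 2%:M -> (m <= \rank (B - N)%R)%N.
Proof.
move=> Npsd BW; rewrite -[X in (X <= _)%N](col_inj_rank (X := (B - N) *m W)).
  exact: mxrankM_maxl.
move=> x; rewrite -mulmxA mulmxBl => /eqP; rewrite subr_eq0 => /eqP BNx.
have [_ /(_ x)] := psd_congr W Npsd; rewrite -!mulmxA -BNx.
have -> : x^T *m (W^T *m (B *m (W *m x))) = - 2 *: (x^T *m x).
  rewrite (mulmxA B) !(mulmxA W^T) BW mulNmx mul_scalar_mx mulmxN.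
  by rewrite -scalemxAr scaleNr.
rewrite mxE => xx; apply: tr_mul_self_eq0.
have : 0 <= (x^T *m x) 0 0.
  by rewrite mxE sumr_ge0 // => i _; rewrite mxE -expr2 sqr_ge0.
by move: xx; move: (_ 0 0) => t; lra.
Qed.

(** Half the sum of the two equations keeps the pure terms, their difference keeps the mixed ones:
    this separates (c) from (b). *)
Lemma mulmx_tr_polarize {F : realFieldType} {m n : nat} {X Y : 'M[F]_(m, n)}
    {J : 'M[F]_m} {Z : 'M[F]_n} :
  Z = (X + Y)^T *m J *m (X + Y) -> Z = (X - Y)^T *m J *m (X - Y) ->
  Z = Y^T *m J *m Y + X^T *m J *m X /\
  Y^T *m J *m X = - (X^T *m J *m Y).
Proof.
have -> : (X + Y)^T = X^T + Y^T by exact: linearD.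
have -> : (X - Y)^T = X^T - Y^T by exact: linearB.
rewrite !(mulmxBl, mulmxBr, mulmxDl, mulmxDr, mulNmx) => Z1 Z2.
have two0 : (2 : F) != 0 by rewrite pnatr_eq0.
split; apply: (scalerI two0); rewrite !scaler_nat !mulr2n.
  by rewrite {1}Z1 Z2 -!addrA; apply/matrixP => i j; rewrite !mxE; ring.
by apply/matrixP => i j; move/matrixP/(_ i j): Z1; rewrite Z2 !mxE; lra.
Qed.

(** * Symmetric matrices in blocks of sizes n, n, p *)

Definition sym_block {R : realType} {n p : nat} (M1 M2 : 'M[R]_n)
    (M2' : 'M_(n, p)) (M3 : 'M_n) (M3' : 'M_(n, p)) (M3'' : 'M_p) :
    'M_(n + (n + p)) :=
  block_mx M1 (row_mx M2 M2') (col_mx M2^T M2'^T)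
           (block_mx M3 M3' M3'^T M3'').

Lemma tr_sym_block {R : realType} {n p : nat} {M1 M2 : 'M[R]_n}
    {M2' : 'M_(n, p)} {M3 : 'M_n} {M3' : 'M_(n, p)} {M3'' : 'M_p} :
  M1^T = M1 -> M3^T = M3 -> M3''^T = M3'' ->
  (sym_block M1 M2 M2' M3 M3' M3'')^T = sym_block M1 M2 M2' M3 M3' M3''.
Proof.
move=> M1s M3s M3''s; rewrite /sym_block !tr_block_mx tr_row_mx tr_col_mx.
by rewrite !trmxK M1s M3s M3''s.
Qed.

Lemma sym_blockE {R : realType} {n p : nat} {N : 'M[R]_(n + (n + p))} :
  N^T = N ->
  N = sym_block (ulsubmx N) (lsubmx (ursubmx N)) (rsubmx (ursubmx N))
        (ulsubmx (drsubmx N)) (ursubmx (drsubmx N)) (drsubmx (drsubmx N)).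
Proof.
move=> Ns; rewrite /sym_block hsubmxK -tr_row_mx hsubmxK trmx_ursub Ns.
by rewrite trmx_ursub trmx_drsub Ns !submxK.
Qed.

Lemma add_sym_block {R : realType} {n p : nat} (M1 M2 : 'M[R]_n)
    (M2' : 'M_(n, p)) (M3 : 'M_n) (M3' : 'M_(n, p)) (M3'' : 'M_p)
    (N1 N2 : 'M_n) (N2' : 'M_(n, p)) (N3 : 'M_n) (N3' : 'M_(n, p))
    (N3'' : 'M_p) :
  sym_block M1 M2 M2' M3 M3' M3'' + sym_block N1 N2 N2' N3 N3' N3'' =
  sym_block (M1 + N1) (M2 + N2) (M2' + N2') (M3 + N3) (M3' + N3')
    (M3'' + N3'').
Proof.
by rewrite /sym_block !add_block_mx add_row_mx add_col_mx !linearD.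
Qed.

Lemma opp_sym_block {R : realType} {n p : nat} (M1 M2 : 'M[R]_n)
    (M2' : 'M_(n, p)) (M3 : 'M_n) (M3' : 'M_(n, p)) (M3'' : 'M_p) :
  - sym_block M1 M2 M2' M3 M3' M3'' =
  sym_block (- M1) (- M2) (- M2') (- M3) (- M3') (- M3'').
Proof. by rewrite /sym_block !opp_block_mx opp_row_mx opp_col_mx !linearN. Qed.

Lemma mul_sym_block_col {R : realType} {n p k : nat} (M1 M2 : 'M[R]_n)
    (M2' : 'M_(n, p)) (M3 : 'M_n) (M3' : 'M_(n, p)) (M3'' : 'M_p)
    (x y : 'M_(n, k)) (z : 'M_(p, k)) :
  sym_block M1 M2 M2' M3 M3' M3'' *m col_mx x (col_mx y z) =
  col_mx (M1 *m x + (M2 *m y + M2' *m z))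
    (col_mx (M2^T *m x + (M3 *m y + M3' *m z))
       (M2'^T *m x + (M3'^T *m y + M3'' *m z))).
Proof.
by rewrite /sym_block !mul_block_col mul_row_col mul_col_mx add_col_mx.
Qed.

Lemma quad_sym_block {R : realType} {n p k l : nat} (M1 M2 : 'M[R]_n)
    (M2' : 'M_(n, p)) (M3 : 'M_n) (M3' : 'M_(n, p)) (M3'' : 'M_p)
    (x y : 'M_(n, k)) (x' y' : 'M_(n, l)) :
  (col_mx x' (col_mx y' 0))^T *m sym_block M1 M2 M2' M3 M3' M3''
    *m col_mx x (col_mx y 0) =
  x'^T *m (M1 *m x + M2 *m y) + y'^T *m (M2^T *m x + M3 *m y).
Proof.
rewrite -mulmxA mul_sym_block_col !tr_col_mx !mul_row_col trmx0 mul0mx.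
by rewrite !mulmx0 !addr0.
Qed.

Definition incl1 {R : realType} {n p : nat} : 'M[R]_(n + (n + p), n) :=
  col_mx 1%:M (col_mx 0 0).

Definition incl2 {R : realType} {n p : nat} : 'M[R]_(n + (n + p), n) :=
  col_mx 0 (col_mx 1%:M 0).

Lemma mul_incl1 {R : realType} {n p k : nat} (x : 'M[R]_(n, k)) :
  (incl1 : 'M_(n + (n + p), n)) *m x = col_mx x (col_mx 0 0).
Proof. by rewrite !mul_col_mx mul1mx !mul0mx. Qed.

Lemma mul_incl2 {R : realType} {n p k : nat} (x : 'M[R]_(n, k)) :
  (incl2 : 'M_(n + (n + p), n)) *m x = col_mx 0 (col_mx x 0).
Proof. by rewrite !mul_col_mx mul1mx !mul0mx. Qed.

Lemma sym_block_coord {R : realType} {n p : nat} (M1 M2 : 'M[R]_n)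
    (M2' : 'M_(n, p)) (M3 : 'M_n) (M3' : 'M_(n, p)) (M3'' : 'M_p)
    (K := sym_block M1 M2 M2' M3 M3' M3'') :
  [/\ incl1^T *m K *m incl1 = M1, incl1^T *m K *m incl2 = M2,
      incl2^T *m K *m incl1 = M2^T & incl2^T *m K *m incl2 = M3].
Proof.
rewrite /K /incl1 /incl2; split; rewrite quad_sym_block;
  by rewrite !(trmx0, trmx1, mul0mx, mulmx0, mul1mx, mulmx1, addr0, add0r).
Qed.

(** The rank bound and the invertible corner [M1] let [rank_factor] write the whole matrix through
    that corner. Reading off the (2, 2) block says that the Schur complement vanishes. *)
Lemma sym_block_schur1 {R : realType} {n p : nat} {M1 M2 : 'M[R]_n}
    {M2' : 'M_(n, p)} {M3 : 'M_n} {M3' : 'M_(n, p)} {M3'' : 'M_p} :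
  (\rank (sym_block M1 M2 M2' M3 M3' M3'') <= n)%N -> M1 \in unitmx ->
  M3 = M2^T *m invmx M1 *m M2.
Proof.
have := sym_block_coord M1 M2 M2' M3 M3' M3''.
set K := sym_block _ _ _ _ _ _ => -[K11 K12 K21 K22] rK M1u.
have := rank_factor (U := incl1^T) (V := incl1) rK; rewrite K11 => /(_ M1u).
move=> /(congr1 (fun X => incl2^T *m X *m incl2)); rewrite K22 => {1}->.
by rewrite -K21 -K12 !mulmxA.
Qed.

Lemma sym_block_schur2 {R : realType} {n p : nat} {M1 M2 : 'M[R]_n}
    {M2' : 'M_(n, p)} {M3 : 'M_n} {M3' : 'M_(n, p)} {M3'' : 'M_p} :
  (\rank (sym_block M1 M2 M2' M3 M3' M3'') <= n)%N -> M3 \in unitmx ->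
  M1 = M2 *m invmx M3 *m M2^T.
Proof.
have := sym_block_coord M1 M2 M2' M3 M3' M3''.
set K := sym_block _ _ _ _ _ _ => -[K11 K12 K21 K22] rK M3u.
have := rank_factor (U := incl2^T) (V := incl2) rK; rewrite K22 => /(_ M3u).
move=> /(congr1 (fun X => incl1^T *m X *m incl1)); rewrite K11 => {1}->.
by rewrite -K21 -K12 !mulmxA.
Qed.

Lemma rank_sym_block0 {R : realType} {n p : nat} {a : 'M[R]_n}
    {b : 'M_(n, p)} :
  a \in unitmx -> \rank (sym_block 0 a b 0 0 0) = (n + n)%N.
Proof.
move=> au; set B := sym_block _ _ _ _ _ _.
have rab : \rank (row_mx a b) = n.
  apply/eqP; rewrite -[_ == _]/(row_free _); apply/row_freeP.
  by exists (col_mx (invmx a) 0); rewrite mul_row_col mulmxV // mulmx0 addr0.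
(* Exchanging the two groups of columns makes [B] block diagonal, with two blocks of rank [n]; this
   gives the lower bound. *)
have swapB : B *m block_mx 0 1%:M 1%:M 0 =
    block_mx (row_mx a b) 0 0 (row_mx a b)^T.
  rewrite /B /sym_block trmx0 block_mx0 mulmx_block tr_row_mx.
  by rewrite !(mul0mx, mulmx0, mulmx1, addr0, add0r).
apply/eqP; rewrite eqn_leq; apply/andP; split; last first.
  have := rank_diag_block_mx (row_mx a b) (row_mx a b)^T.
  by rewrite mxrank_tr rab => <-; rewrite -swapB mxrankM_maxl.
(* The solutions of [a *m y + b *m z = 0], parametrised by [z]: [p] independent null vectors, hence
   the upper bound. *)
pose W : 'M[R]_(n + (n + p), p) := col_mx 0 (col_mx (- (invmx a *m b)) 1%:M).
have BW : B *m W = 0.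
  rewrite mul_sym_block_col !(mulmx0, mul0mx, mulmx1, addr0) mulmxN mulKVmx //.
  by rewrite addNr trmx0 mul0mx !addr0 !col_mx0.
have rW : \rank W = p.
  apply: col_inj_rank => x; rewrite !mul_col_mx mul1mx => W0.
  by move/eqP: W0; rewrite !col_mx_eq0 => /and3P[_ _ /eqP].
by have := mulmx0_rank_max BW; rewrite rW; lia.
Qed.

Lemma Ker_sym_block {R : realType} {n p : nat} {a : 'M[R]_n}
    {b : 'M_(n, p)} {M1 M2 : 'M_n} {M2' : 'M_(n, p)} {M3 : 'M_n}
    {M3' : 'M_(n, p)} {M3'' : 'M_p} :
  a \in unitmx -> M3^T = M3 ->
  (Ker (sym_block 0 a b 0 0 0) <= Ker (sym_block M1 M2 M2' M3 M3' M3''))%VS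
  <-> [/\ M2' = M2 *m invmx a *m b, M3' = M3 *m invmx a *m b
         & M3'' = b^T *m (invmx a)^T *m M3 *m invmx a *m b].
Proof.
move=> au M3s; rewrite Ker_subP; split=> [BN|[M2'E M3'E M3''E] k W].
  (* The columns of this matrix form a basis of the kernel of the first matrix; the three block rows
     of the resulting equation are the three equations of (d). *)
  have := BN _ (col_mx 0 (col_mx (- (invmx a *m b)) 1%:M)).
  rewrite !mul_sym_block_col !(mulmx0, mul0mx, mulmx1, addr0, add0r) !mulmxN.
  rewrite mulKVmx // addNr trmx0 mul0mx oppr0 !col_mx0 => /(_ erefl)/eqP.
  rewrite !col_mx_eq0 => /and3P[/eqP M2E /eqP M3E /eqP M3''E].
  have eqE q (X Y : 'M[R]_(q, p)) : - X + Y = 0 -> Y = X.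
    by move/eqP; rewrite addrC subr_eq0 => /eqP.
  split; first by rewrite -mulmxA; apply: eqE.
    by rewrite -mulmxA; apply: eqE.
  rewrite (eqE _ _ _ M3''E) (eqE _ _ _ M3E) !trmx_mul M3s.
  by rewrite !mulmxA.
rewrite -[W]vsubmxK -[dsubmx W]vsubmxK; 
move: (usubmx W) (usubmx (dsubmx W)) (dsubmx (dsubmx W)).
move=> x y z; rewrite !mul_sym_block_col !(mul0mx, add0r, trmx0, addr0).
move/eqP; rewrite !col_mx_eq0 addr_eq0 => /and3P[/eqP abE /eqP ax _].
(* Conversely every kernel element has this shape: the second block row gives [x = 0], the first
   expresses [y] through [z]. *)
have -> : x = 0.
  by rewrite -[x](mulKmx (_ : a^T \in unitmx)) ?unitmx_tr // ax mulmx0.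
have -> : y = - (invmx a *m b *m z).
  by rewrite -[y](mulKmx au) abE mulmxN mulmxA.
rewrite M3''E M3'E M2'E !trmx_mul M3s !mulmxN !mulmx0 !add0r !mulmxA !addNr.
by rewrite !col_mx0.
Qed.

Lemma psd_sym_block {R : realType} {n p : nat} {a : 'M[R]_n}
    {b : 'M_(n, p)} {M1 M2 : 'M_n} {M2' : 'M_(n, p)} {M3 : 'M_n}
    {M3' : 'M_(n, p)} {M3'' : 'M_p} :
  a \in unitmx -> posdef M1 ->
  M3 = a^T *m invmx M1 *m a + M2^T *m invmx M1 *m M2 ->
  M2' = M2 *m invmx a *m b -> M3' = M3 *m invmx a *m b ->
  M3'' = b^T *m (invmx a)^T *m M3 *m invmx a *m b ->
  psd (sym_block M1 M2 M2' M3 M3' M3'').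
Proof.
move=> au M1pos M3E M2'E M3'E M3''E.
have M1u := posdef_unit M1pos; have [M1s _] := M1pos.
(* [M1 *m X] is the first block row of the matrix to be shown semidefinite, and [M1 *m Y] is
   [(0 | a | b)], the first block row of [B]. *)
pose X := row_mx 1%:M (row_mx (invmx M1 *m M2) (invmx M1 *m M2')).
pose Y : 'M[R]_(n, n + (n + p)) :=
  row_mx 0 (row_mx (invmx M1 *m a) (invmx M1 *m b)).
suff -> : sym_block M1 M2 M2' M3 M3' M3'' = X^T *m M1 *m X + Y^T *m M1 *m Y.
  by apply: psdD; apply: psd_congr; apply: posdef_psd.
have M3s : M3^T = M3.
  by rewrite M3E linearD /= !trmx_mul !trmxK trmx_inv M1s !mulmxA.
have MX : M1 *m X = row_mx M1 (row_mx M2 M2').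
  by rewrite /X !mul_mx_row mulmx1 !mulKVmx.
have MY : M1 *m Y = row_mx 0 (row_mx a b).
  by rewrite /Y !mul_mx_row mulmx0 !mulKVmx.
rewrite -!mulmxA MX MY /X /Y !tr_row_mx !mul_col_row !trmx1 !trmx0.
rewrite !(mul1mx, mul0mx, mulmx0) !trmx_mul !trmx_inv M1s.
rewrite add_block_mx !addr0 /sym_block; congr block_mx.
  by rewrite mul_col_mx !mulmxKV.
(* Multiplying the formula for [M3] by [invmx a *m b] on the right turns [M2] into [M2'] and [a]
   into [b]. *)
have M3'D : M3' = M2^T *m invmx M1 *m M2' + a^T *m invmx M1 *m b.
  by rewrite M3'E M3E M2'E addrC !mulmxDl !mulmxA mulmxK.
rewrite add_block_mx; congr block_mx => //; first by rewrite addrC.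
  by rewrite M3'D linearD /= !trmx_mul !trmxK trmx_inv M1s !mulmxA.
have aa : (invmx a)^T *m a^T = 1%:M by rewrite -trmx_mul mulmxV ?trmx1.
rewrite M3''E -!mulmxA (mulmxA M3) -M3'E M3'D !mulmxDr M2'E !trmx_mul.
by rewrite !mulmxA -(mulmxA _ (invmx a)^T a^T) aa mulmx1.
Qed.

(** * The characterisation for block matrices *)

Lemma friedrichs_sym_block {R : realType} {n p : nat} {a : 'M[R]_n}
    {b : 'M_(n, p)} {M1 M2 : 'M_n} {M2' : 'M_(n, p)} {M3 : 'M_n}
    {M3' : 'M_(n, p)} {M3'' : 'M_p}
    (B := sym_block 0 a b 0 0 0) (N := sym_block M1 M2 M2' M3 M3' M3'') :
  a \in unitmx -> N^T = N -> M3^T = M3 ->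
  friedrichs_admissible B N <->
  [/\ posdef M1 /\ posdef M3,
      skew_sym (a^T *m invmx M1 *m M2) /\ skew_sym (a *m invmx M3 *m M2^T),
      M3 = a^T *m invmx M1 *m a + M2^T *m invmx M1 *m M2 /\
      M1 = a *m invmx M3 *m a^T + M2 *m invmx M3 *m M2^T,
      [/\ M2' = M2 *m invmx a *m b, M3' = M3 *m invmx a *m b
        & M3'' = b^T *m (invmx a)^T *m M3 *m invmx a *m b]
    & \rank (B + N)%R = n /\ \rank (B - N)%R = n].
Proof.
move=> au Ns M3s.
have Bs : B^T = B by rewrite tr_sym_block ?trmx0.
have rB : \rank B = (n + n)%N by exact: rank_sym_block0.
split=> [BN|[[M1pos M3pos] _ [M3E _] [M2'E M3'E M3''E] [rD rS]]]; last first.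
  have BN : (Ker B <= Ker N)%VS by apply/Ker_sym_block.
  split=> //; first exact: psd_sym_block M3E M2'E M3'E M3''E.
  by apply/Ker_add_rank; rewrite // rB rS rD.
have [Npsd KBN] := BN; move/(Ker_add_rank Bs Ns KBN); rewrite rB => rSD.
have rS : (n <= \rank (B - N)%R)%N.
  (* Graph of [- invmx a]: the form of [B] there is [a *m (- invmx a)] plus its transpose, that is
     [- 2%:M]. *)
  apply: (rank_sub_psd (W := col_mx 1%:M (col_mx (- invmx a) 0)) Npsd).
  rewrite quad_sym_block !(trmx0, trmx1, mul0mx, mulmx0, mul1mx, mulmx1).
  rewrite !(addr0, add0r) -trmx_mul mulmxN mulmxV // linearN /= trmx1.
  by rewrite -opprD -raddfD.
have rD : (n <= \rank (B + N)%R)%N.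
  (* Up to sign [B + N] is [- B - N], so the same bound applies to [- B], on the graph of
     [invmx a]. *)
  rewrite -mxrank_opp opprD.
  apply: (rank_sub_psd (W := col_mx 1%:M (col_mx (invmx a) 0)) Npsd).
  rewrite mulmxN mulNmx.
  rewrite quad_sym_block !(trmx0, trmx1, mul0mx, mulmx0, mul1mx, mulmx1).
  rewrite !(addr0, add0r) -trmx_mul mulmxV // trmx1.
  by rewrite -raddfD.
have [rDn rSn] : \rank (B + N)%R = n /\ \rank (B - N)%R = n by lia.
have [N11 N12 N21 N22] := sym_block_coord M1 M2 M2' M3 M3' M3''.
have M1pos : posdef M1.
  rewrite -N11; apply: psd_posdef_congr => // x /(friedrichs_Ker BN)/eqP.
  rewrite mul_incl1 mul_sym_block_col !col_mx_eq0.
  rewrite !(mulmx0, addr0) => /and3P[_ /eqP ax _].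
  by rewrite -[x](mulKmx (_ : a^T \in unitmx)) ?unitmx_tr // ax mulmx0.
have M3pos : posdef M3.
  rewrite -N22; apply: psd_posdef_congr => // x /(friedrichs_Ker BN)/eqP.
  rewrite mul_incl2 mul_sym_block_col !col_mx_eq0.
  rewrite !(mulmx0, mul0mx, addr0, add0r) => /and3P[/eqP ax _ _].
  by rewrite -[x](mulKmx au) ax mulmx0.
have M1u := posdef_unit M1pos; have M3u := posdef_unit M3pos.
have [M1s _] := M1pos.
have NDB : N + B = sym_block M1 (M2 + a) (M2' + b) M3 M3' M3''.
  by rewrite add_sym_block !addr0.
have NBB : N - B = sym_block M1 (M2 - a) (M2' - b) M3 M3' M3''.
  by rewrite opp_sym_block add_sym_block !(oppr0, addr0).
have rNDB : (\rank (sym_block M1 (M2 + a) (M2' + b) M3 M3' M3'') <= n)%N.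
  by rewrite -NDB addrC rDn.
have rNBB : (\rank (sym_block M1 (M2 - a) (M2' - b) M3 M3' M3'') <= n)%N.
  by rewrite -NBB -mxrank_opp opprB rSn.
have [M3E sk1] := mulmx_tr_polarize (sym_block_schur1 rNDB M1u)
  (sym_block_schur1 rNBB M1u).
(* The same argument with pivot [M3], where [M2^T] and [a^T] take the places of [M2] and [a]. *)
have [M1E sk2] : M1 = a *m invmx M3 *m a^T + M2 *m invmx M3 *m M2^T /\
    a *m invmx M3 *m M2^T = - (M2 *m invmx M3 *m a^T).
  have ED : M1 = (M2^T + a^T)^T *m invmx M3 *m (M2^T + a^T).
    by rewrite -[M2^T + _]linearD trmxK; exact: sym_block_schur2 rNDB M3u.
  have ES : M1 = (M2^T - a^T)^T *m invmx M3 *m (M2^T - a^T).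
    by rewrite -[M2^T - _]linearB trmxK; exact: sym_block_schur2 rNBB M3u.
  by have := mulmx_tr_polarize ED ES; rewrite !trmxK.
split=> //.
- split; rewrite /skew_sym.
    by rewrite {1}sk1 linearN /= !trmx_mul !trmxK trmx_inv M1s mulmxA.
  by rewrite {1}sk2 linearN /= !trmx_mul !trmxK trmx_inv M3s mulmxA.
- exact: (Ker_sym_block au M3s).1 KBN.
Qed.

(** * Transfer to the original pair by conjugation *)

Theorem theorem3p4 (R : realType) (lam mu : R)
  (mu_gt0 : 0 < mu) (lam_mu_gt0 : 0 < 2%:R * mu + 3%:R * lam)
  (nu : 'rV[R]_3) (nuS : on_sphere nu)
  (C : 'M[R]_(3 + (3 + 3))) (HC : admissible lam mu nu C)
  (M : 'M[R]_(3 + (3 + 3))) (Msym : M^T = M) :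
  let Anu := A lam mu nu in
  let Ah := C *m Anu *m C^T in
  let Ah' := blk12 Ah in
  let Ah'' := blk13 Ah in
  let Mh := C *m M *m C^T in
  let M1 := blk11 Mh in
  let M2 := blk12 Mh in
  let M2' := blk13 Mh in
  let M3 := blk22 Mh in
  let M3' := blk23 Mh in
  let M3'' := blk33 Mh in
  [/\ psd M,
      (Ker Anu <= Ker M)%VS
    & (Ker (Anu - M) + Ker (Anu + M))%VS = fullv]
  <->
  [/\ posdef M1 /\ posdef M3,
      skew_sym (Ah'^T *m invmx M1 *m M2) /\
      skew_sym (Ah' *m invmx M3 *m M2^T),
      M3 = Ah'^T *m invmx M1 *m Ah' + M2^T *m invmx M1 *m M2 /\
      M1 = Ah' *m invmx M3 *m Ah'^T + M2 *m invmx M3 *m M2^T,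
      [/\ M2' = M2 *m invmx Ah' *m Ah'',
          M3' = M3 *m invmx Ah' *m Ah''
        & M3'' = Ah''^T *m (invmx Ah')^T *m M3 *m invmx Ah' *m Ah'']
    & \rank (Anu + M)%R = 3%N /\ \rank (Anu - M)%R = 3%N].
Proof.
move=> Anu Ah Ah' Ah'' Mh M1 M2 M2' M3 M3' M3''.
case: HC => /is_perm_mxP[s Cs] CT C1 Au.
have CC : C *m C^T = 1%:M by rewrite Cs tr_perm_mx -perm_mxM mulgV perm_mx1.
have Cu : C \in unitmx by case: (mulmx1_unit CC).
have As : Anu^T = Anu.
  by rewrite /Anu /A tr_block_mx !trmx0 tr_row_mx tr_col_mx !trmxK.
(* Symmetry of [C] carries the prescribed first three rows over to the columns, so [C] only permutes
   the last six coordinates, and conjugation by it keeps the two zero diagonal blocks of [Anu]. *)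
have CE : C = block_mx 1%:M 0 0 (drsubmx C).
  rewrite -{1}[C]submxK; congr block_mx.
  - by rewrite /ulsubmx C1 row_mxKl.
  - by rewrite /ursubmx C1 row_mxKr.
  - by rewrite -CT -trmx_ursub /ursubmx C1 row_mxKr trmx0.
have congrs (X : 'M_(3 + (3 + 3))) :
    X^T = X -> (C *m X *m C^T)^T = C *m X *m C^T.
  by move=> Xs; rewrite !trmx_mul trmxK Xs mulmxA.
have Mhs : Mh^T = Mh by exact: congrs.
have [Ah0 Ah0'] : ulsubmx Ah = 0 /\ drsubmx Ah = 0.
  rewrite /Ah CE /Anu /A tr_block_mx !mulmx_block.
  rewrite block_mxKul block_mxKdr.
  by rewrite !(trmx0, mulmx0, mul0mx, addr0, add0r).
have AhE : Ah = sym_block 0 Ah' Ah'' 0 0 0.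
  rewrite [LHS](sym_blockE (congrs _ As)) Ah0 Ah0' /ulsubmx /ursubmx /drsubmx.
  by rewrite !linear0.
have MhE : Mh = sym_block M1 M2 M2' M3 M3' M3'' by exact: sym_blockE.
(* Condition (e) concerns the original matrices; their ranks are those of the conjugates. *)
have rankC (X : 'M_(3 + (3 + 3))) : \rank (C *m X *m C^T) = \rank X.
  rewrite mxrankMfree ?row_free_unit ?unitmx_tr //.
  by rewrite -mxrank_tr trmx_mul mxrankMfree ?mxrank_tr //
    row_free_unit unitmx_tr.
rewrite -(rankC (Anu + M)) -(rankC (Anu - M)).
rewrite !(mulmxBr, mulmxDr, mulmxBl, mulmxDl) -/Ah -/Mh.
have M3s : M3^T = M3 by rewrite /M3 /blk22 trmx_ulsub trmx_drsub Mhs.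
apply: iff_trans (iff_sym (friedrichs_admissible_congrE CC)) _.
rewrite -/Ah -/Mh AhE MhE.
apply: friedrichs_sym_block => //.
by rewrite -MhE.
Qed.
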